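(* Let $p$ be an odd prime and let $G$ be a group with $|G|=p^n$ and $|Z(G)|=p^{n-2}$. Then the chromatic number of the commuting graph $\zeta(G,G)$ is $p^{n-1}$.
   Context: $Z(G)$ is the center of $G$. The commuting graph $\zeta(G,G)$ is the simple graph with vertex set $G$ in which two distinct vertices are adjacent if and only if they commute in $G$. *)

(* Defs.v *)
From HB Require Import structures.
From mathcomp Require Import all_boot all_fingroup all_solvable.

Set Implicit Arguments.
Unset Strict Implicit.
Unset Printing Implicit Defensive.

Record sgraph := SGraph {
  vertex :> finType;
  edge : rel vertex;
  edge_sym : symmetric edge;
  edge_irrefl : irreflexive edge }.

Definition proper_coloring (g : sgraph) (k : nat) (c : {ffun g -> 'I_k}) : bool :=
  [forall x : g, forall y : g, edge x y ==> (c x != c y)].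

Definition colorable (g : sgraph) (k : nat) : bool :=
  [exists c : {ffun g -> 'I_k}, proper_coloring c].

Lemma colorable_ex (g : sgraph) : exists k, colorable g k.
Proof.
exists #|g|; apply/existsP; exists [ffun x => enum_rank x].
apply/'forall_forallP=> x y; apply/implyP=> xy; rewrite !ffunE.
by apply: contraTneq xy => /enum_rank_inj->; rewrite edge_irrefl.
Qed.

Definition chromatic_number (g : sgraph) : nat := ex_minn (colorable_ex g).

Section CommutingGraph.

Variables (gT : finGroupType) (G : {group gT}).

Definition commuting_edge : rel [subg G] :=
  fun x y => (x != y) && (x * y == y * x)%g.

Lemma commuting_edge_sym : symmetric commuting_edge.
Proof.
by move=> x y; rewrite /commuting_edge [x == y]eq_sym [(x * y)%g == _]eq_sym.
Qed.

Lemma commuting_edge_irrefl : irreflexive commuting_edge.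
Proof. by move=> x; rewrite /commuting_edge eqxx. Qed.

Definition commuting_graph : sgraph :=
  SGraph commuting_edge_sym commuting_edge_irrefl.

End CommutingGraph.

(* Main.v *)
Require Import Defs.
From mathcomp Require Import all_boot all_fingroup all_solvable.

(** Each centralizer of a non-central element lies strictly between [Z(G)] and
    [G], so it has order [p^(n-1)]; its own center contains [Z(G)] and the
    element, so it is abelian.  One such centralizer is a clique of the required
    size.  Conversely, commuting non-central elements have the same centralizer,
    so numbering [Z(G)] first and then, independently in each centralizer [C],
    the elements of [C :\: Z(G)] is a proper coloring with [p^(n-1)] colors. *)

Lemma chromatic_number_le (g : sgraph) (k : nat) :
  colorable g k -> chromatic_number g <= k.
Proof. by rewrite /chromatic_number; case: ex_minnP => m _; apply. Qed.

(** A proper coloring is injective on a clique. *)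
Lemma clique_le_chromatic_number (g : sgraph) (A : {set g}) :
  {in A &, forall x y, x != y -> edge x y} -> #|A| <= chromatic_number g.
Proof.
move=> cliqueA; rewrite /chromatic_number; case: ex_minnP => m + _.
case/existsP=> c /'forall_forallP col_c.
rewrite -(card_in_imset (f := c)).
  by rewrite (leq_trans (max_card _)) ?card_ord.
move=> x y Ax Ay eq_c; apply: contraTeq isT => /(cliqueA _ _ Ax Ay) xy.
by have /implyP/(_ xy) := col_c x y; rewrite eq_c eqxx.
Qed.

Lemma commuting_edgeP (gT : finGroupType) (G : {group gT}) (x y : [subg G]) :
  reflect (sgval x <> sgval y /\ commute (sgval x) (sgval y))
          (edge (s := commuting_graph G) x y).
Proof.
apply: (iffP andP) => [[/eqP neq_xy /eqP cxy]|[neq_xy cxy]]; split.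
- by move/val_inj.
- exact: (congr1 sgval cxy).
- by apply/eqP=> eq_xy; case: neq_xy; rewrite eq_xy.
- by apply/eqP/val_inj.
Qed.

(** Both orders are powers of [p], so strict inclusion raises the exponent by at least one. *)
Lemma pgroup_proper_card (p m : nat) (gT : finGroupType) (H K : {group gT}) :
    prime p -> (p.-group K)%g -> #|H| = p ^ m -> H \proper K ->
  p ^ m.+1 <= #|K|.
Proof.
move=> p_pr pK cardH /proper_card; have [k ->] := p_natP pK.
by rewrite cardH ltn_exp2l ?prime_gt1 // leq_exp2l ?prime_gt1.
Qed.

Section CenterOfIndexSquare.

Local Open Scope group_scope.

Variables (p m : nat) (gT : finGroupType) (G : {group gT}).
Hypotheses (p_pr : prime p) (cardG : #|G| = (p ^ m.+2)%N).
Hypothesis cardZ : #|'Z(G)| = (p ^ m)%N.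

Let pG : p.-group G.
Proof. by rewrite /pgroup cardG pnatX pnat_id. Qed.

Let pC x : p.-group 'C_G[x].
Proof. exact: pgroupS (subsetIl _ _) pG. Qed.

Lemma center_sub_cent1 x : x \in G -> 'Z(G) \subset 'C_G[x].
Proof. by move=> Gx; rewrite setIS // -cent_set1 centS // sub1set. Qed.

Lemma card_cent1_noncentral x :
  x \in G :\: 'Z(G) -> #|'C_G[x]| = (p ^ m.+1)%N.
Proof.
case/setDP=> Gx nZx.
have ltZC : 'Z(G) \proper 'C_G[x].
  rewrite properE center_sub_cent1 //; apply/subsetPn.
  by exists x; rewrite // inE Gx cent1id.
have ltCG : 'C_G[x] \proper G.
  rewrite properE subsetIl; apply: contra nZx => /subsetP sGC.
  apply/centerP; split=> // y /sGC/setIP[_ /cent1P]; exact: commute_sym.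
have geC := pgroup_proper_card p m _ 'Z(G) 'C_G[x] p_pr (pC x) cardZ ltZC.
apply/eqP; rewrite eqn_leq geC andbT.
(* Upper bound: the order is some [p ^ k] below [p ^ m.+2], hence [k <= m.+1]. *)
have := proper_card ltCG; rewrite cardG; have [k /= ->] := p_natP (pC x).
by rewrite ltn_exp2l ?leq_exp2l ?prime_gt1.
Qed.

Lemma cent1_noncentral_abelian x : x \in G :\: 'Z(G) -> abelian 'C_G[x].
Proof.
move=> nZx; have cardC := card_cent1_noncentral x nZx.
case/setDP: (nZx) => Gx nZGx.
(* It suffices that the center of ['C_G[x]] has at least [p ^ m.+1] elements, which holds once it
   properly contains ['Z(G)]; [x] is the witness. *)
apply/center_idP/eqP; rewrite eqEcard center_sub /= cardC.
apply: (pgroup_proper_card p m _ 'Z(G) 'Z('C_G[x]) p_pr _ cardZ).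
  exact: pgroupS (center_sub _) (pC x).
rewrite properE; apply/andP; split.
  rewrite subsetI center_sub_cent1 // (subset_trans (subsetIr _ _)) //.
  by rewrite centS // subsetIl.
apply/subsetPn; exists x => //; apply/centerP; split=> [|y].
  by rewrite inE Gx cent1id.
by case/setIP=> _ /cent1P.
Qed.

(** The abelian group ['C_G[x]] contains [y], hence centralizes it; the reverse inclusion is
    symmetric. *)
Lemma commuting_cent1_eq x y :
    x \in G :\: 'Z(G) -> y \in G :\: 'Z(G) -> commute x y ->
  'C_G[x] = 'C_G[y].
Proof.
have sub u v : u \in G :\: 'Z(G) -> v \in G :\: 'Z(G) -> commute u v ->
    'C_G[u] \subset 'C_G[v].
  move=> nZu /setDP[Gv _] cuv; rewrite subsetI subsetIl /= -(cent_set1 v).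
  apply: subset_trans (cent1_noncentral_abelian u nZu) _.
  by rewrite centS // sub1set inE Gv; apply/cent1P.
move=> nZx nZy cxy; apply/eqP; rewrite eqEsubset !sub //.
Qed.

(** The color of [x] will be its position in this list, which depends on [x] only through ['C_G[x]].
    The initial segment [enum 'Z(G)] is common to all the lists, so a central element has the same
    position in each. *)
Definition center_first (x : gT) : seq gT :=
  enum 'Z(G) ++ enum ('C_G[x] :\: 'Z(G)).

Lemma mem_center_first x : x \in G -> x \in center_first x.
Proof.
by move=> Gx; rewrite mem_cat !mem_enum in_setD in_setI Gx cent1id /= andbT orbN.
Qed.

Lemma index_center_first_central x y :
  x \in 'Z(G) -> index x (center_first y) = index x (enum 'Z(G)).
Proof. by move=> Zx; rewrite index_cat mem_enum Zx. Qed.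

(** For central [x] the list runs through all of [G] and is too long, but [x] sits among its first
    [p ^ m] entries. Otherwise the whole list has length [#|'C_G[x]|]. *)
Lemma index_center_first_lt x :
  x \in G -> index x (center_first x) < p ^ m.+1.
Proof.
move=> Gx; have [Zx | nZx] := boolP (x \in 'Z(G)).
  rewrite index_center_first_central //.
  have: index x (enum 'Z(G)) < size (enum 'Z(G)) by rewrite index_mem mem_enum.
  rewrite -cardE cardZ => /leq_trans; apply.
  by rewrite leq_pexp2l // prime_gt0.
have: index x (center_first x) < size (center_first x).
  by rewrite index_mem mem_center_first.
rewrite size_cat -!cardE -{1}(setIidPr (center_sub_cent1 x Gx)) cardsID.
by rewrite card_cent1_noncentral // inE nZx.
Qed.

(** In each case both positions can be read in a single list: if one element is central, the list of
    the other serves; if neither is, their centralizers, and so their lists, coincide. *)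
Lemma index_center_first_inj x y :
    x \in G -> y \in G -> commute x y ->
  index x (center_first x) = index y (center_first y) -> x = y.
Proof.
move=> Gx Gy cxy.
have inj s u v : u \in s -> v \in s -> index u s = index v s -> u = v :> gT.
  by move=> su sv eq_i; rewrite -(nth_index u su) eq_i nth_index.
have Zmem u v : u \in 'Z(G) -> u \in center_first v.
  by move=> Zu; rewrite mem_cat mem_enum Zu.
have [Zx | nZx] := boolP (x \in 'Z(G)).
  rewrite index_center_first_central // -(index_center_first_central x y Zx).
  by apply: inj; [apply: Zmem | apply: mem_center_first].
have [Zy | nZy] := boolP (y \in 'Z(G)).
  rewrite (index_center_first_central y y Zy).
  rewrite -(index_center_first_central y x Zy).
  by apply: inj; [apply: mem_center_first | apply: Zmem].
have eqC : center_first x = center_first y.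
  by rewrite /center_first (commuting_cent1_eq x y) // inE ?nZx ?nZy.
by rewrite eqC; apply: inj; rewrite -?eqC ?mem_center_first // eqC mem_center_first.
Qed.

Lemma commuting_graph_colorable : colorable (commuting_graph G) (p ^ m.+1).
Proof.
apply/existsP.
exists [ffun x : commuting_graph G =>
  Ordinal (index_center_first_lt (sgval x) (subgP x))].
apply/'forall_forallP=> x y; apply/implyP=> /commuting_edgeP[neq_xy cxy].
rewrite !ffunE; apply/eqP=> -[] /index_center_first_inj eq_xy.
by apply: neq_xy; apply: eq_xy; rewrite ?subgP.
Qed.

Lemma commuting_graph_chromatic :
  chromatic_number (commuting_graph G) = (p ^ m.+1)%N.
Proof.
apply/eqP; rewrite eqn_leq chromatic_number_le ?commuting_graph_colorable //=.
have /properP[_ [x Gx nZx]] : 'Z(G) \proper G.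
  by rewrite properEcard center_sub cardZ cardG ltn_exp2l ?prime_gt1 // ltnS leqnSn.
have GZx : x \in G :\: 'Z(G) by rewrite inE nZx.
(* Lower bound: the image of ['C_G[x]] in the vertex type [[subg G]] is a clique of size
   [p ^ m.+1]. *)
rewrite -(card_cent1_noncentral x GZx).
rewrite -(card_in_imset (f := subg G) (D := 'C_G[x])).
  apply: (@clique_le_chromatic_number (commuting_graph G)).
  move=> _ _ /imsetP[y Cy ->] /imsetP[z Cz ->] neq_yz.
  have [[Gy _] [Gz _]] := (setIP Cy, setIP Cz).
  apply/commuting_edgeP; split.
    by move/val_inj=> eq_yz; rewrite eq_yz eqxx in neq_yz.
  by rewrite !subgK //; apply: (centsP (cent1_noncentral_abelian x GZx)).
move=> y z /setIP[Gy _] /setIP[Gz _] /(congr1 sgval).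
by rewrite !subgK.
Qed.

End CenterOfIndexSquare.

Theorem proposition3p4 (p n : nat) (gT : finGroupType) (G : {group gT})
    (p_prime : prime p) (p_odd : odd p) (n_ge2 : 2 <= n)
    (cardG : #|G| = p ^ n) (cardZ : #|'Z(G)%g| = p ^ (n - 2)) :
  chromatic_number (commuting_graph G) = p ^ (n - 1).
Proof.
(* Writing [n] as [m.+2] removes the truncated subtractions. *)
case: n n_ge2 cardG cardZ => [|[|m]] // _ cardG.
by rewrite !subSS !subn0; apply: commuting_graph_chromatic.
Qed.
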